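(* Let $X$ be a scheme over a field $K$ with $\mathrm{char}(K)\ne2,3$. Let $E$ be a locally free sheaf (of finite rank $M$) over $X$, $\mathcal U=\{U_i\}_{i\in I}$ a Zariski open cover of $X$ ($I$ an ordered set), and $g=\{g_{ij}\}$ a system of transition functions of $E$ with respect to $\mathcal U$. For $i_1,i_2\in I$ define $t_{i_1i_2}\in\Gamma(U_{i_1i_2},\Omega^1)$ by $$t_{i_1i_2}:=\sum_{\sigma\in S_2}\frac{\mathrm{sgn}(\sigma)}{2!}\,\mathrm{tr}\big(g^{-1}_{i_{\sigma(1)}i_{\sigma(2)}}dg_{i_{\sigma(1)}i_{\sigma(2)}}\big)=\mathrm{tr}\big(g^{-1}_{i_1i_2}dg_{i_1i_2}\big),$$ and define the Čech $1$-cochain $\widehat f^r_{1,\mathcal U}(E):=(t_{i_1i_2})_{i_1<i_2}$ with $t_{i_1i_2}\in\Gamma(U_{i_1i_2},d\Omega^0)$. Then $\widehat f^r_{1,\mathcal U}(E)$ is a Čech $1$-cocycle and hence defines an element $f^r_{1,\mathcal U}(E)\in\check H^1(\mathcal U,d\Omega^0)$; moreover, $f^r_{1,\mathcal U}(E)$ is independent of the choice of $g$. Denote by $f_1^r(E)$ the image of $f^r_{1,\mathcal U}(E)$ in $\check H^1(X,d\Omega^0)$ under the canonical homomorphism. Then $f_1^r(E)$ is independent of the choice of $\mathcal U$.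
   Context: $\Omega^1=\Omega_{X/\mathrm{Spec}\,K}$ is the sheaf of Kähler differentials, $\Omega^k$ its $k$-th exterior power, $d$ the exterior derivative of the algebraic de Rham complex, and $d\Omega^0$ is the sheaf of $d$-closed sections of $\Omega^1$ (as in the complex case, where $d\Omega^q$ denotes the sheaf of closed $(q+1)$-forms). A trivialization of $E$ with respect to $\mathcal U$ is a family of isomorphisms $\phi_i:E|_{U_i}\to\mathcal O_{U_i}^{M}$; its transition functions are $g_{ij}=\phi_i\circ\phi_j^{-1}\in GL_M(\mathcal O_X(U_i\cap U_j))$; $dg_{ij}$ is the entrywise differential. $U_{i_1i_2}=U_{i_1}\cap U_{i_2}$. Čech $k$-cochains are families of sections indexed by $i_1<\cdots<i_{k+1}$ with differential $(\partial s)_{i_1\cdots i_{k+2}}=\sum_j(-1)^{j+1}s_{i_1\cdots\widehat{i_j}\cdots i_{k+2}}$; $\check H^k(X,\cdot)=\varinjlim_{\mathcal U}\check H^k(\mathcal U,\cdot)$ over Zariski open covers under refinement. $f_1^r(E)$ is called the refined first $T$ invariant of $E$. *)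

(* Defs.v *)
From Stdlib Require Import Relations.
From HB Require Import structures.
From mathcomp Require Import all_boot all_order perm all_algebra.
From mathcomp Require Import boolp classical_sets topology.

Set Implicit Arguments.
Unset Strict Implicit.
Unset Printing Implicit Defensive.

Import Order.TTheory GRing.Theory.
Local Open Scope classical_set_scope.
Local Open Scope quotient_scope.
Local Open Scope ring_scope.

Definition dprod (I : Type) (V : I -> zmodType) := forall i, V i.

Section DProd.
Variables (I : Type) (V : I -> zmodType).

HB.instance Definition _ := gen_eqMixin (dprod V).
HB.instance Definition _ := gen_choiceMixin (dprod V).

Let zero : dprod V := fun=> 0.
Let opp (f : dprod V) : dprod V := fun i => - f i.
Let add (f g : dprod V) : dprod V := fun i => f i + g i.

Fact dprod_addA : associative add.
Proof. by move=> f g h; apply: functional_extensionality_dep => i; apply: addrA. Qed.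
Fact dprod_addC : commutative add.
Proof. by move=> f g; apply: functional_extensionality_dep => i; apply: addrC. Qed.
Fact dprod_add0 : left_id zero add.
Proof. by move=> f; apply: functional_extensionality_dep => i; apply: add0r. Qed.
Fact dprod_addN : left_inverse zero opp add.
Proof. by move=> f; apply: functional_extensionality_dep => i; apply: addNr. Qed.

HB.instance Definition _ :=
  GRing.isZmodule.Build (dprod V) dprod_addA dprod_addC dprod_add0 dprod_addN.

Lemma dprod0E i : (0 : dprod V) i = 0. Proof. by []. Qed.
Lemma dprodDE (f g : dprod V) i : (f + g) i = f i + g i. Proof. by []. Qed.
Lemma dprodNE (f : dprod V) i : (- f) i = - f i. Proof. by []. Qed.
Lemma dprodBE (f g : dprod V) i : (f - g) i = f i - g i. Proof. by []. Qed.
End DProd.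

Record opens (X : topologicalType) :=
  Opens { oset :> set X; open_oset : open oset }.

Definition oT (X : topologicalType) : opens X := Opens (@openT X).
Definition oI (X : topologicalType) (U V : opens X) : opens X :=
  Opens (openI (open_oset U) (open_oset V)).

(* Restriction maps take the proof of the inclusion as an argument; the second
   law below, applied with an identity, makes them independent of that proof. *)
Definition is_presheaf (X : topologicalType) (F : opens X -> Type)
    (res : forall U V : opens X, V `<=` U -> F U -> F V) : Prop :=
  (forall (U : opens X) (h : U `<=` U) (s : F U), res U U h s = s) /\
  (forall (U V W : opens X) (h1 : V `<=` U) (h2 : W `<=` V) (h3 : W `<=` U)
      (s : F U), res V W h2 (res U V h1 s) = res U W h3 s).

Definition is_sheaf (X : topologicalType) (F : opens X -> Type)
    (res : forall U V : opens X, V `<=` U -> F U -> F V) : Prop :=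
  is_presheaf res /\
  forall (W : opens X) (I : Type) (U : I -> opens X)
      (sub : forall i, U i `<=` W) (s : forall i, F (U i)),
    (W `<=` \bigcup_i oset (U i)) ->
    (forall i j, res (U i) (oI (U i) (U j)) (@subIsetl _ _ _) (s i) =
                 res (U j) (oI (U i) (U j)) (@subIsetr _ _ _) (s j)) ->
    exists! t : F W, forall i, res W (U i) (sub i) t = s i.

Record abSheaf (X : topologicalType) := AbSheaf {
  ab_sec :> opens X -> zmodType;
  ab_res : forall U V : opens X, V `<=` U -> {additive ab_sec U -> ab_sec V};
  ab_sheafP : is_sheaf (fun U V h => ab_res h) }.

(* [comPzRingType] admits the zero ring, which is the ring of sections over the
   empty set. *)
Record ringSheaf (X : topologicalType) := RingSheaf {
  rg_sec :> opens X -> comPzRingType;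
  rg_res : forall U V : opens X, V `<=` U -> {rmorphism rg_sec U -> rg_sec V};
  rg_sheafP : is_sheaf (fun U V h => rg_res h) }.

Record modSheaf (X : topologicalType) (O : ringSheaf X) := ModSheaf {
  md_sec :> forall U : opens X, lmodType (O U);
  md_res : forall U V : opens X, V `<=` U -> {additive md_sec U -> md_sec V};
  md_resZ : forall (U V : opens X) (h : V `<=` U) (a : O U) (s : md_sec U),
    md_res h (a *: s) = rg_res O h a *: md_res h s;
  md_sheafP : is_sheaf (fun U V h => md_res h) }.

Record modHom (X : topologicalType) (O : ringSheaf X) (F G : modSheaf O) :=
  ModHom {
  mh_fun :> forall U : opens X, {linear F U -> G U};
  mh_res : forall (U V : opens X) (h : V `<=` U) (s : F U),
    mh_fun V (md_res F h s) = md_res G h (mh_fun U s) }.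

Definition is_prime_ideal (A : comPzRingType) (P : set A) : Prop :=
  [/\ P 0, forall a b, P a -> P b -> P (a + b), forall a b, P b -> P (a * b),
      ~ P 1 & forall a b, P (a * b) -> P a \/ P b].

Record spec (A : comPzRingType) :=
  Spec { spec_ideal :> set A; specP : is_prime_ideal spec_ideal }.

Definition zariski_open (A : comPzRingType) (W : set (spec A)) : Prop :=
  exists S : set A, W = [set p : spec A | exists2 f, S f & ~ spec_ideal p f].

Definition basic_open (A : comPzRingType) (f : A) : set (spec A) :=
  [set p : spec A | ~ spec_ideal p f].

(* [l : A -> B] is a localization of A at the powers of f, i.e. B = A_f. *)
Definition is_localization_at (A B : comPzRingType) (f : A)
    (l : {rmorphism A -> B}) : Prop :=
  [/\ exists g, l f * g = 1,
      forall b, exists a n, b * l f ^+ n = l a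
    & forall a, l a = 0 -> exists n, f ^+ n * a = 0].

(* (U, O|U) is isomorphic to Spec A for some A: phi is a homeomorphism, and under
   it O has the sections of the structure sheaf of Spec A over the basic opens,
   namely O(D(f)) = A_f, as A-algebras; these values determine the sheaf. *)
Definition is_affine (X : topologicalType) (O : ringSheaf X) (U : opens X) :
    Prop :=
  exists (A : comPzRingType) (phi : set_type U -> spec A)
         (iota : {rmorphism A -> O U}),
    [/\ bijective phi,
        forall W : set (spec A),
          zariski_open W <-> open [set val u | u in phi @^-1` W]
      & forall (f : A) (V : opens X) (h : V `<=` U),
          V = [set val u | u in phi @^-1` basic_open f] :> set X ->
          is_localization_at f (rg_res O h \o iota)].

(* A morphism to Spec K is a ring morphism K -> O_X(X).  Stalks of a locally
   affine ringed space are local, so that condition need not be imposed. *)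
Record schemeOver (K : fieldType) := SchemeOver {
  sc_space :> topologicalType;
  sc_O : ringSheaf sc_space;
  sc_str : {rmorphism K -> sc_O (oT sc_space)};
  sc_affine : forall x : sc_space, exists2 U : opens sc_space,
    oset U x & is_affine sc_O U }.

Notation "\O_ X" := (sc_O X) (at level 8, X at level 2, format "\O_ X").

Definition sc_const (K : fieldType) (X : schemeOver K) (U : opens X) (c : K) :
  \O_X U := rg_res \O_X (U := oT X) (@subsetT _ U) (sc_str X c).

Arguments sc_const {K X} U c.

Record derivation (K : fieldType) (X : schemeOver K) (F : modSheaf \O_X) :=
  Derivation {
  dv_fun :> forall U : opens X, {additive \O_X U -> F U};
  dv_res : forall (U V : opens X) (h : V `<=` U) (a : \O_X U),
    dv_fun V (rg_res \O_X h a) = md_res F h (dv_fun U a);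
  dv_mul : forall (U : opens X) (a b : \O_X U),
    dv_fun U (a * b) = a *: dv_fun U b + b *: dv_fun U a;
  dv_const : forall (U : opens X) (c : K), dv_fun U (sc_const U c) = 0 }.

Definition is_kaehler (K : fieldType) (X : schemeOver K) (Om : modSheaf \O_X)
    (d : derivation Om) : Prop :=
  forall (F : modSheaf \O_X) (D : derivation F), exists u : modHom Om F,
    (forall (U : opens X) (a : \O_X U), D U a = u U (d U a)) /\
    (forall u' : modHom Om F,
       (forall (U : opens X) (a : \O_X U), D U a = u' U (d U a)) ->
       forall (U : opens X) (s : Om U), u' U s = u U s).

Record altPairing (X : topologicalType) (O : ringSheaf X) (F G : modSheaf O) :=
  AltPairing {
  ap_fun :> forall U : opens X, F U -> F U -> G U;
  ap_res : forall (U V : opens X) (h : V `<=` U) (s t : F U),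
    ap_fun (md_res F h s) (md_res F h t) = md_res G h (ap_fun s t);
  ap_linl : forall (U : opens X) (a : O U) (s s' t : F U),
    ap_fun (a *: s + s') t = a *: ap_fun s t + ap_fun s' t;
  ap_linr : forall (U : opens X) (a : O U) (s t t' : F U),
    ap_fun s (a *: t + t') = a *: ap_fun s t + ap_fun s t';
  ap_alt : forall (U : opens X) (s : F U), ap_fun s s = 0 }.

Definition is_exterior_square (X : topologicalType) (O : ringSheaf X)
    (F G : modSheaf O) (w : altPairing F G) : Prop :=
  forall (H : modSheaf O) (b : altPairing F H), exists u : modHom G H,
    (forall (U : opens X) (s t : F U), b U s t = u U (w U s t)) /\
    (forall u' : modHom G H,
       (forall (U : opens X) (s t : F U), b U s t = u' U (w U s t)) ->
       forall (U : opens X) (z : G U), u' U z = u U z).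

(* The terms Omega^0 -> Omega^1 -> Omega^2 of the algebraic de Rham complex of
   X/K, given by their universal properties, hence unique up to a unique
   isomorphism. *)
Record deRham (K : fieldType) (X : schemeOver K) := DeRham {
  dR_Om1 : modSheaf \O_X;
  dR_d0 : derivation dR_Om1;
  dR_kaehler : is_kaehler dR_d0;
  dR_Om2 : modSheaf \O_X;
  dR_wedge : altPairing dR_Om1 dR_Om2;
  dR_exterior : is_exterior_square dR_wedge;
  dR_d1 : forall U : opens X, {additive dR_Om1 U -> dR_Om2 U};
  dR_d1_res : forall (U V : opens X) (h : V `<=` U) (s : dR_Om1 U),
    dR_d1 V (md_res dR_Om1 h s) = md_res dR_Om2 h (dR_d1 U s);
  dR_d1_leibniz : forall (U : opens X) (a : \O_X U) (s : dR_Om1 U),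
    dR_d1 U (a *: s) = dR_wedge U (dR_d0 U a) s + a *: dR_d1 U s;
  dR_d1_d0 : forall (U : opens X) (a : \O_X U), dR_d1 U (dR_d0 U a) = 0 }.

Section ClosedForms.
Variables (K : fieldType) (X : schemeOver K) (D : deRham X).
Implicit Types U V : opens X.

Definition closed_pred U : {pred dR_Om1 D U} := fun s => dR_d1 D U s == 0.

Fact closed_pred_zmod U : zmod_closed (@closed_pred U).
Proof.
split=> [|s t /eqP ds /eqP dt]; apply/eqP; first exact: raddf0.
by rewrite raddfB ds dt subrr.
Qed.

HB.instance Definition _ U :=
  GRing.isZmodClosed.Build (dR_Om1 D U) (@closed_pred U) (@closed_pred_zmod U).

Record closed_form U :=
  ClosedForm { cf_val :> dR_Om1 D U; cfP : cf_val \in @closed_pred U }.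

HB.instance Definition _ U := [isSub for @cf_val U].
HB.instance Definition _ U := [Choice of closed_form U by <:].
HB.instance Definition _ U := [SubChoice_isSubZmodule of closed_form U by <:].

Definition closed_form_of U (s : dR_Om1 D U) (ds : dR_d1 D U s = 0) :
  closed_form U := ClosedForm (introT eqP ds).

Fact cf_res_closed U V (h : V `<=` U) (s : closed_form U) :
  md_res (dR_Om1 D) h (cf_val s) \in @closed_pred V.
Proof.
by apply/eqP; rewrite dR_d1_res; case: s => s /eqP /= ->; rewrite raddf0.
Qed.

Definition cf_res U V (h : V `<=` U) (s : closed_form U) : closed_form V :=
  ClosedForm (cf_res_closed h s).

Fact cf_res_additive U V (h : V `<=` U) : zmod_morphism (cf_res h).
Proof. by move=> s t; apply: val_inj => /=; apply: raddfB. Qed.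

HB.instance Definition _ U V (h : V `<=` U) :=
  GRing.isZmodMorphism.Build (closed_form U) (closed_form V) (cf_res h)
    (cf_res_additive h).

Fact cf_sheaf : is_sheaf (fun U V (h : V `<=` U) => cf_res h).
Proof.
have [[res1 resM] glue1] := md_sheafP (dR_Om1 D).
have [_ glue2] := md_sheafP (dR_Om2 D).
split.
  by split=> *; apply: val_inj => /=; [apply: res1 | apply: resM].
move=> W I U sub s cov compat.
have [|t [ts tuniq]] := glue1 W I U sub (fun i => cf_val (s i)) cov.
  by move=> i j; exact: (congr1 (@cf_val (oI (U i) (U j))) (compat i j)).
have dt : dR_d1 D W t = 0.
  have [|z [_ zuniq]] := glue2 W I U sub (fun=> 0) cov.
    by move=> i j; rewrite !raddf0.
  rewrite -(zuniq 0) ?(zuniq (dR_d1 D W t))// => i; last by rewrite raddf0.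
  by rewrite -dR_d1_res ts; exact: (eqP (cfP (s i))).
exists (closed_form_of dt); split.
  by move=> i; apply: val_inj; apply: ts.
move=> t' t's; apply: val_inj; apply: tuniq => i.
exact: (congr1 (@cf_val (U i)) (t's i)).
Qed.

Definition closedForms : abSheaf X := AbSheaf cf_sheaf.
End ClosedForms.

Record openCover (X : topologicalType) := OpenCover {
  cv_disp : Order.disp_t;
  cv_idx : orderType cv_disp;
  cv_set :> cv_idx -> opens X;
  cv_cover : forall x, exists i, oset (cv_set i) x }.

Section Cech.
Variables (X : topologicalType) (F : abSheaf X).
Implicit Types (C : openCover X) (U V W : opens X).

Record simplex1 C := Simplex1 {
  s1_0 : cv_idx C; s1_1 : cv_idx C; s1_lt : (s1_0 < s1_1)%O }.
Record simplex2 C := Simplex2 {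
  s2_0 : cv_idx C; s2_1 : cv_idx C; s2_2 : cv_idx C;
  s2_lt01 : (s2_0 < s2_1)%O; s2_lt12 : (s2_1 < s2_2)%O }.

Definition s2_lt02 C (p : simplex2 C) : (s2_0 p < s2_2 p)%O :=
  lt_trans (s2_lt01 p) (s2_lt12 p).

Definition U1 C (i j : cv_idx C) : opens X := oI (C i) (C j).
Definition U2 C (i j k : cv_idx C) : opens X := oI (oI (C i) (C j)) (C k).

Fact U1_l C (i j : cv_idx C) : U1 i j `<=` C i. Proof. by move=> x []. Qed.
Fact U1_r C (i j : cv_idx C) : U1 i j `<=` C j. Proof. by move=> x []. Qed.
Fact U2_01 C (i j k : cv_idx C) : U2 i j k `<=` U1 i j. Proof. by move=> x []. Qed.
Fact U2_12 C (i j k : cv_idx C) : U2 i j k `<=` U1 j k. Proof. by move=> x [[]]. Qed.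
Fact U2_02 C (i j k : cv_idx C) : U2 i j k `<=` U1 i k. Proof. by move=> x [[]]. Qed.
Fact U1_swap C (i j : cv_idx C) : U1 i j `<=` U1 j i. Proof. by move=> x []. Qed.

Definition cochain0 C := dprod (fun i : cv_idx C => F (C i)).
Definition cochain1 C := dprod (fun p : simplex1 C => F (U1 (s1_0 p) (s1_1 p))).
Definition cochain2 C :=
  dprod (fun p : simplex2 C => F (U2 (s2_0 p) (s2_1 p) (s2_2 p))).

Definition cech_d0 C (c : cochain0 C) : cochain1 C := fun p =>
  ab_res F (@U1_r C _ _) (c (s1_1 p)) - ab_res F (@U1_l C _ _) (c (s1_0 p)).

Definition cech_d1 C (s : cochain1 C) : cochain2 C := fun p =>
  ab_res F (@U2_12 C _ _ _) (s (Simplex1 (s2_lt12 p)))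
  - ab_res F (@U2_02 C _ _ _) (s (Simplex1 (s2_lt02 p)))
  + ab_res F (@U2_01 C _ _ _) (s (Simplex1 (s2_lt01 p))).

Fact cech_d1_additive C : zmod_morphism (@cech_d1 C).
Proof.
move=> s t; apply: functional_extensionality_dep => p.
rewrite dprodBE /cech_d1 !dprodBE !raddfB /=.
rewrite !opprD !opprK -!addrA; congr (_ + _); rewrite !addrA.
by rewrite [LHS](ACl (2*4*1*3*5)).
Qed.

HB.instance Definition _ C :=
  GRing.isZmodMorphism.Build (cochain1 C) (cochain2 C) (@cech_d1 C)
    (@cech_d1_additive C).

Fact cech_d0_additive C : zmod_morphism (@cech_d0 C).
Proof.
move=> s t; apply: functional_extensionality_dep => p.
rewrite dprodBE /cech_d0 !dprodBE !raddfB /=.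
by rewrite !opprK !addrA [LHS](ACl (1*3*2*4)).
Qed.

HB.instance Definition _ C :=
  GRing.isZmodMorphism.Build (cochain0 C) (cochain1 C) (@cech_d0 C)
    (@cech_d0_additive C).

Definition is_cocycle C : {pred cochain1 C} := fun s => cech_d1 s == 0.

Fact is_cocycle_zmod C : zmod_closed (@is_cocycle C).
Proof.
split=> [|s t /eqP ds /eqP dt]; apply/eqP; first exact: raddf0.
by rewrite [LHS]cech_d1_additive ds dt subrr.
Qed.

HB.instance Definition _ C :=
  GRing.isZmodClosed.Build (cochain1 C) (@is_cocycle C) (@is_cocycle_zmod C).

Record cocycle1 C :=
  Cocycle1 { cc_val :> cochain1 C; ccP : cc_val \in @is_cocycle C }.

HB.instance Definition _ C := [isSub for @cc_val C].
HB.instance Definition _ C := [Choice of cocycle1 C by <:].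
HB.instance Definition _ C := [SubChoice_isSubZmodule of cocycle1 C by <:].

Definition cocycle_of C (s : cochain1 C) (ds : cech_d1 s = 0) : cocycle1 C :=
  Cocycle1 (introT eqP ds).

Definition is_coboundary C : {pred cocycle1 C} :=
  fun z => `[< exists c : cochain0 C, cc_val z = cech_d0 c >].

Lemma is_coboundaryP C (z : cocycle1 C) :
  reflect (exists c : cochain0 C, cc_val z = cech_d0 c) (z \in @is_coboundary C).
Proof. exact: asboolP. Qed.

Fact is_coboundary_zmod C : zmod_closed (@is_coboundary C).
Proof.
split=> [|y z /is_coboundaryP[c yc] /is_coboundaryP[e ze]]; apply/is_coboundaryP.
  by exists 0; rewrite raddf0.
by exists (c - e); rewrite [RHS]cech_d0_additive -yc -ze.
Qed.

HB.instance Definition _ C :=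
  GRing.isZmodClosed.Build (cocycle1 C) (@is_coboundary C) (@is_coboundary_zmod C).

Definition cechH1 C : zmodType := Quotient.quot (@is_coboundary C).

Definition cech_class C (z : cocycle1 C) : cechH1 C := \pi_(Quotient.quot (@is_coboundary C)) z.

(* The alternating extension of a cochain to all pairs of indices, by which it is
   pulled back along refinements that need not be increasing on indices. *)
Definition cochain1_alt C (s : cochain1 C) (i j : cv_idx C) : F (U1 i j) :=
  if pselect (i < j)%O is left ij then s (Simplex1 ij)
  else if pselect (j < i)%O is left ji
       then - ab_res F (@U1_swap C _ _) (s (Simplex1 ji))
       else 0.

Definition is_refinement C C' (r : cv_idx C' -> cv_idx C) : Prop :=
  forall j, C' j `<=` C (r j).

Fact U1_refine C C' (r : cv_idx C' -> cv_idx C) (hr : is_refinement r)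
  (i j : cv_idx C') : U1 i j `<=` U1 (r i) (r j).
Proof. by move=> x [/hr ? /hr ?]; split. Qed.

Definition cochain1_pull C C' (r : cv_idx C' -> cv_idx C) (hr : is_refinement r)
    (s : cochain1 C) : cochain1 C' :=
  fun q => ab_res F (@U1_refine _ _ _ hr _ _) (cochain1_alt s (r (s1_0 q)) (r (s1_1 q))).

Lemma ab_res_id U (h : U `<=` U) (s : F U) : ab_res F h s = s.
Proof. by have [[+ _] _] := ab_sheafP F; apply. Qed.

Lemma ab_resM U V W (h1 : V `<=` U) (h2 : W `<=` V) (h3 : W `<=` U) (s : F U) :
  ab_res F h2 (ab_res F h1 s) = ab_res F h3 s.
Proof. by have [[_ +] _] := ab_sheafP F; apply. Qed.

Lemma cochain1_alt_lt C (s : cochain1 C) (i j : cv_idx C) (ij : (i < j)%O) :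
  cochain1_alt s i j = s (Simplex1 ij).
Proof.
rewrite /cochain1_alt; case: pselect => // ij'.
by rewrite (bool_irrelevance ij' ij).
Qed.

Lemma cochain1_alt_gt C (s : cochain1 C) (i j : cv_idx C) (ji : (j < i)%O) :
  cochain1_alt s i j = - ab_res F (@U1_swap C _ _) (s (Simplex1 ji)).
Proof.
rewrite /cochain1_alt; case: pselect => ij; first by have := lt_asym i j; rewrite ij ji.
by case: pselect => // ji'; rewrite (bool_irrelevance ji' ji).
Qed.

Lemma cochain1_alt_eq C (s : cochain1 C) (i : cv_idx C) : cochain1_alt s i i = 0.
Proof.
have ii : ~ (i < i)%O by rewrite ltxx.
by rewrite /cochain1_alt; case: pselect => // ?; case: pselect.
Qed.

Lemma cochain1_altN C (s : cochain1 C) (i j : cv_idx C) W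
    (h : W `<=` U1 i j) (h' : W `<=` U1 j i) :
  ab_res F h (cochain1_alt s i j) = - ab_res F h' (cochain1_alt s j i).
Proof.
case: (ltgtP i j) h h' => [ij|ji|->] h h'; last by rewrite cochain1_alt_eq !raddf0.
- by rewrite (cochain1_alt_lt s ij) (cochain1_alt_gt s ij) raddfN opprK (ab_resM _ _ h).
- by rewrite (cochain1_alt_lt s ji) (cochain1_alt_gt s ji) raddfN (ab_resM _ _ h').
Qed.

Lemma cochain1_altB C (s t : cochain1 C) (i j : cv_idx C) :
  cochain1_alt (s - t) i j = cochain1_alt s i j - cochain1_alt t i j.
Proof.
have [ij|ji|->] := ltgtP i j; last by rewrite !cochain1_alt_eq subrr.
- by rewrite !(cochain1_alt_lt _ ij).
- by rewrite !(cochain1_alt_gt _ ji) dprodBE !raddfB.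
Qed.

Lemma cochain1_alt_cocycle C (s : cochain1 C) (i j k : cv_idx C) W
    (hjk : W `<=` U1 j k) (hik : W `<=` U1 i k) (hij : W `<=` U1 i j) :
  s \in @is_cocycle C ->
  ab_res F hjk (cochain1_alt s j k) - ab_res F hik (cochain1_alt s i k)
  + ab_res F hij (cochain1_alt s i j) = 0.
Proof.
move=> /eqP ds.
pose P i j k := forall (hjk : W `<=` U1 j k) (hik : W `<=` U1 i k)
  (hij : W `<=` U1 i j), ab_res F hjk (cochain1_alt s j k)
  - ab_res F hik (cochain1_alt s i k) + ab_res F hij (cochain1_alt s i j) = 0.
have sw (x y : cv_idx C) : W `<=` U1 x y -> W `<=` U1 y x by move=> h z /h [].
have P12 x y z : P x y z -> P y x z.
  move=> Pxyz h1 h2 h3; rewrite (cochain1_altN s h3 (sw _ _ h3)).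
  have /eqP := Pxyz h2 h1 (sw _ _ h3); rewrite -oppr_eq0 !opprD !opprK => /eqP <-.
  by rewrite [RHS](ACl (2*1*3)).
have P23 x y z : P x y z -> P x z y.
  move=> Pxyz h1 h2 h3; rewrite (cochain1_altN s h1 (sw _ _ h1)).
  have /eqP := Pxyz (sw _ _ h1) h3 h2; rewrite -oppr_eq0 !opprD !opprK => /eqP <-.
  by rewrite [RHS](ACl (1*3*2)).
have Plt x y z : (x < y)%O -> (y < z)%O -> P x y z.
  move=> xy yz h1 h2 h3.
  have xz := lt_trans xy yz.
  have h : W `<=` U2 x y z by move=> w wW; split; [apply: h3 | case: (h1 w wW)].
  have := congr1 (fun f : cochain2 C => ab_res F h (f (Simplex2 xy yz))) ds.
  rewrite /cech_d1 /= raddfD raddfB /= raddf0.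
  rewrite (ab_resM _ _ h1) (ab_resM _ _ h2) (ab_resM _ _ h3).
  rewrite -(cochain1_alt_lt s (s2_lt12 (Simplex2 xy yz))).
  rewrite -(cochain1_alt_lt s (s2_lt02 (Simplex2 xy yz))).
  by rewrite -(cochain1_alt_lt s (s2_lt01 (Simplex2 xy yz))).
have Peq x z : P x x z.
  move=> h1 h2 h3; rewrite cochain1_alt_eq raddf0 addr0.
  rewrite -[ab_res F h1 _](@ab_res_id _ (fun=> id)) -[ab_res F h2 _](@ab_res_id _ (fun=> id)).
  by rewrite !(ab_resM _ _ h2) subrr.
suff: P i j k by apply.
have [ij|ji|->] := ltgtP i j; last exact: Peq.
- have [jk|kj|->] := ltgtP j k; first exact: Plt.
  + have [ik|ki|->] := ltgtP i k.
    * exact/P23/Plt.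
    * exact/P23/P12/Plt.
    * exact/P23/Peq.
  + exact/P12/P23/Peq.
- have [ik|ki|->] := ltgtP i k.
  + exact/P12/Plt.
  + have [jk|kj|->] := ltgtP j k.
    * exact/P12/P23/Plt.
    * exact/P12/P23/P12/Plt.
    * exact/P12/P23/Peq.
  + exact/P23/Peq.
Qed.

Fact cochain1_pull_additive C C' (r : cv_idx C' -> cv_idx C)
  (hr : is_refinement r) : zmod_morphism (cochain1_pull hr).
Proof.
move=> s t; apply: functional_extensionality_dep => q.
by rewrite dprodBE /cochain1_pull cochain1_altB raddfB.
Qed.

Fact cochain1_pull_cocycle C C' (r : cv_idx C' -> cv_idx C)
    (hr : is_refinement r) (z : cocycle1 C) :
  cochain1_pull hr (cc_val z) \in @is_cocycle C'.
Proof.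
apply/eqP; apply: functional_extensionality_dep => p.
have h12 : U2 (s2_0 p) (s2_1 p) (s2_2 p) `<=` U1 (r (s2_1 p)) (r (s2_2 p)).
  by move=> x /U2_12; apply: U1_refine.
have h02 : U2 (s2_0 p) (s2_1 p) (s2_2 p) `<=` U1 (r (s2_0 p)) (r (s2_2 p)).
  by move=> x /U2_02; apply: U1_refine.
have h01 : U2 (s2_0 p) (s2_1 p) (s2_2 p) `<=` U1 (r (s2_0 p)) (r (s2_1 p)).
  by move=> x /U2_01; apply: U1_refine.
rewrite /cech_d1 /cochain1_pull /= (ab_resM _ _ h12) (ab_resM _ _ h02).
by rewrite (ab_resM _ _ h01) cochain1_alt_cocycle ?ccP.
Qed.

Definition cocycle1_pull C C' (r : cv_idx C' -> cv_idx C)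
    (hr : is_refinement r) (z : cocycle1 C) : cocycle1 C' :=
  Cocycle1 (cochain1_pull_cocycle hr z).

Lemma cochain1_alt_d0 C (c : cochain0 C) (i j : cv_idx C) :
  cochain1_alt (cech_d0 c) i j =
  ab_res F (@U1_r C i j) (c j) - ab_res F (@U1_l C i j) (c i).
Proof.
have [ij|ji|->] := ltgtP i j.
- by rewrite (cochain1_alt_lt _ ij).
- rewrite (cochain1_alt_gt _ ji) /cech_d0 /= raddfB /= opprB.
  by rewrite (ab_resM _ _ (@U1_r C i j)) (ab_resM _ _ (@U1_l C i j)).
- rewrite cochain1_alt_eq -[ab_res F (@U1_r C j j) _](@ab_res_id _ (fun=> id)).
  by rewrite (ab_resM _ _ (@U1_l C j j)) subrr.
Qed.

Fact cocycle1_pull_coboundary C C' (r : cv_idx C' -> cv_idx C)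
    (hr : is_refinement r) (z : cocycle1 C) :
  z \in @is_coboundary C -> cocycle1_pull hr z \in @is_coboundary C'.
Proof.
move=> /is_coboundaryP[c zc]; apply/is_coboundaryP.
exists (fun j => ab_res F (@hr j) (c (r j))).
apply: functional_extensionality_dep => q /=.
rewrite /cochain1_pull zc cochain1_alt_d0 raddfB /= /cech_d0.
have hl : U1 (s1_0 q) (s1_1 q) `<=` C (r (s1_0 q)) by move=> x /U1_l /hr.
have hR : U1 (s1_0 q) (s1_1 q) `<=` C (r (s1_1 q)) by move=> x /U1_r /hr.
by rewrite !(ab_resM _ _ hl) !(ab_resM _ _ hR).
Qed.

Definition cechH1_pull C C' (r : cv_idx C' -> cv_idx C)
    (hr : is_refinement r) (a : cechH1 C) : cechH1 C' :=
  cech_class (cocycle1_pull hr (repr a)).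

Lemma cech_class_eq C (y z : cocycle1 C) :
  cech_class y = cech_class z <-> y - z \in @is_coboundary C.
Proof.
rewrite /cech_class; split; first by move/eqP; rewrite -Quotient.idealrBE.
by move=> yz; apply/eqP; rewrite -Quotient.idealrBE.
Qed.

Lemma cechH1_pullE C C' (r : cv_idx C' -> cv_idx C)
    (hr : is_refinement r) (z : cocycle1 C) :
  cechH1_pull hr (cech_class z) = cech_class (cocycle1_pull hr z).
Proof.
apply/cech_class_eq; set y := repr _.
have yz : y - z \in @is_coboundary C.
  by apply/cech_class_eq; rewrite /cech_class reprK.
suff <- : cocycle1_pull hr (y - z) = cocycle1_pull hr y - cocycle1_pull hr z.
  exact: cocycle1_pull_coboundary.
by apply: val_inj; apply: cochain1_pull_additive.
Qed.

(* The direct limit of the H^1(C) over all covers C under refinement: classes of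
   elements of the H^1(C), for the equivalence generated by a ~ r^* a.  The system
   is filtered, so this is the underlying set of the direct limit of groups; it
   lies in a universe above that of the carriers of [zmodType]. *)
Definition cech_germ : Type := {C : openCover X & cechH1 C}.

Definition cech_step (a b : cech_germ) : Prop :=
  exists (r : cv_idx (projT1 b) -> cv_idx (projT1 a)) (hr : is_refinement r),
    projT2 b = cechH1_pull hr (projT2 a).

Definition cech_equiv : cech_germ -> cech_germ -> Prop :=
  clos_refl_sym_trans cech_germ cech_step.

Record cechH1X := CechH1X {
  cech_members :> cech_germ -> Prop;
  cech_membersP : exists a, cech_members = cech_equiv a }.

Definition cech_can C (a : cechH1 C) : cechH1X :=
  @CechH1X (cech_equiv (existT _ C a)) (ex_intro _ (existT _ C a) erefl).

Lemma cech_can_eq C C' (a : cechH1 C) (b : cechH1 C') :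
  cech_can a = cech_can b <->
  cech_equiv (existT _ C a : cech_germ) (existT _ C' b : cech_germ).
Proof.
split=> [/(congr1 cech_members) /= ->|ab]; first exact: rst_refl.
have e : cech_equiv (existT _ C a) = cech_equiv (existT _ C' b).
  apply: funext => c; apply: propext; split=> h.
    exact: (rst_trans _ _ _ _ _ (rst_sym _ _ _ _ ab) h).
  exact: (rst_trans _ _ _ _ _ ab h).
rewrite /cech_can; move: (ex_intro _ _ _) (ex_intro _ _ _); rewrite e => p q.
by rewrite (Prop_irrelevance p q).
Qed.

End Cech.

Section Trivialization.
Variables (X : topologicalType) (O : ringSheaf X) (M : nat) (E : modSheaf O).

(* An isomorphism E|U -> O_U^M. *)
Record localTriv (U : opens X) := LocalTriv {
  lt_fun : forall V : opens X, V `<=` U -> {linear E V -> 'cV[O V]_M};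
  lt_inv : forall V : opens X, V `<=` U -> 'cV[O V]_M -> E V;
  lt_funK : forall (V : opens X) (h : V `<=` U), cancel (lt_fun h) (lt_inv h);
  lt_invK : forall (V : opens X) (h : V `<=` U), cancel (lt_inv h) (lt_fun h);
  lt_res : forall (V W : opens X) (h : V `<=` U) (k : W `<=` V) (l : W `<=` U)
    (s : E V), lt_fun l (md_res E k s) = map_mx (rg_res O k) (lt_fun h s) }.

Definition locally_free : Prop :=
  forall x : X, exists2 U : opens X, oset U x & inhabited (localTriv U).

Definition trivialization (C : openCover X) := forall i : cv_idx C, localTriv (C i).

(* The matrix of phi_i o phi_j^-1 on U_i `&` U_j. *)
Definition transition (C : openCover X) (phi : trivialization C) (i j : cv_idx C) :
    'M[O (U1 i j)]_M :=
  \matrix_(a, b) lt_fun (phi i) (@U1_l _ C i j)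
    (lt_inv (phi j) (@U1_r _ C i j) (delta_mx b 0)) a 0.

Definition transition_family (C : openCover X) :=
  forall i j : cv_idx C, 'M[O (U1 i j)]_M.

Definition is_transition_system (C : openCover X) (g : transition_family C) : Prop :=
  exists phi : trivialization C, forall i j, g i j = transition phi i j.

End Trivialization.

(* The inverse in GL_n(R); [invmx] is not available over a [comPzRingType]. *)
Definition invGL (R : comPzRingType) (n : nat) (A : 'M[R]_n) : 'M[R]_n :=
  xget A [set B : 'M[R]_n | A *m B = 1%:M /\ B *m A = 1%:M].

Definition mulmx_form (R : pzRingType) (V : lmodType R) (n : nat)
    (A : 'M[R]_n) (B : 'M[V]_n) : 'M[V]_n :=
  \matrix_(a, b) \sum_c A a c *: B c b.

Section T1.
Variables (K : fieldType) (X : schemeOver K) (D : deRham X).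
Variables (M : nat) (C : openCover X) (g : transition_family \O_X M C).
Implicit Types i j : cv_idx C.

Definition tr_dlog i j : dR_Om1 D (U1 i j) :=
  \tr (mulmx_form (invGL (g i j)) (map_mx (dR_d0 D (U1 i j)) (g i j))).

Definition pair_idx i j : 'I_2 -> cv_idx C := fun k => if k == ord0 then i else j.

Fact pair_idx_sub i j (s : 'S_2) :
  U1 i j `<=` U1 (pair_idx i j (s ord0)) (pair_idx i j (s ord_max)).
Proof.
have sub k : U1 i j `<=` C (pair_idx i j k).
  by rewrite /pair_idx => x [xi xj]; case: ifP.
by move=> x xij; split; apply: sub.
Qed.

Definition T1_form i j : dR_Om1 D (U1 i j) :=
  \sum_(s : 'S_2)
    sc_const (U1 i j) ((-1) ^+ odd_perm s / (2`!)%:R) *: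
    md_res (dR_Om1 D) (@pair_idx_sub i j s)
      (tr_dlog (pair_idx i j (s ord0)) (pair_idx i j (s ord_max))).

Definition T1_cochain (cl : forall i j, dR_d1 D _ (T1_form i j) = 0) :
    cochain1 (closedForms D) C :=
  fun p => closed_form_of (cl (s1_0 p) (s1_1 p)).

Definition T1_class (cl : forall i j, dR_d1 D _ (T1_form i j) = 0)
    (cc : cech_d1 (T1_cochain cl) = 0) : cechH1 (closedForms D) C :=
  cech_class (cocycle_of cc).

End T1.

(* Main.v *)
From Stdlib Require Import Relations.
Require Import Defs.
From mathcomp Require Import all_boot all_order perm all_algebra.
From mathcomp Require Import boolp classical_sets topology.

Import Order.TTheory GRing.Theory.
Local Open Scope classical_set_scope.
Local Open Scope ring_scope.

Set Implicit Arguments.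
Unset Strict Implicit.
Unset Printing Implicit Defensive.

(** The statement rests on one fact: dlog A = tr (A^-1 dA) turns products of
    invertible matrices into sums ([dlogM]), and its values are closed
    ([dlog_closed]).

    Additivity is the Leibniz rule plus invariance of the trace under cyclic
    permutations.  For closedness, d(B) = - B dA B where B = A^-1, hence
    d (dlog A) = - tr (theta /\ theta) with theta = B dA.  Relabelling the
    indices of this double sum and using that the wedge is antisymmetric shows
    that it equals its opposite, so it vanishes because 2 is invertible.

    For two local trivializations p and q and an open set W on which both are
    defined, let L(p, q) = dlog (p o q^-1), a closed form on W.  Since
    (p o q^-1) (q o r^-1) = p o r^-1, additivity gives
    L(p, q) + L(q, r) = L(p, r) ([triv_dlogD]).  All the assertions follow from
    this single relation.  Antisymmetry L(q, p) = - L(p, q) identifies the two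
    expressions of t.  The relation for p_i, p_j, p_k is the cocycle identity.
    For two systems p and q of trivializations over the same cover,
    L(p_i, p_j) - L(q_i, q_j) = L(q_j, p_j) - L(q_i, p_i) is the coboundary of
    the 0-cochain L(q_k, p_k) ([triv_cochainB]).  Finally, pulling the class of
    p back along a refinement r gives the class of the system k |-> p_(r k)
    ([triv_class_pull]); so on a common refinement of two covers the two
    pulled back classes come from two systems of trivializations over the same
    cover, and therefore agree ([triv_can_indep]). *)

(** * Logarithmic derivative of an invertible matrix *)

Lemma invGLE (R : comPzRingType) n (A B : 'M[R]_n) :
  A *m B = 1%:M -> invGL A = B.
Proof.
move=> AB; have BA := mulmx1C AB; apply: xget_unique; first by [].
by move=> C [_ CA]; rewrite -[C]mulmx1 -AB mulmxA CA mul1mx.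
Qed.

Definition dlog (R : comPzRingType) (V : lmodType R) (d : R -> V) n
    (A : 'M[R]_n) : V :=
  \tr (mulmx_form (invGL A) (map_mx d A)).

Section LogarithmicDerivative.
Variables (R : comPzRingType) (V : lmodType R) (d : {additive R -> V}).
Hypothesis d_mul : forall a b, d (a * b) = a *: d b + b *: d a.

(** The double sum involves only left multiplications of forms by scalars, so that
    the Leibniz rule and the relations between A and B apply entry by entry. *)
Lemma dlogE n (A B : 'M[R]_n) : A *m B = 1%:M ->
  dlog d A = \sum_a \sum_c B a c *: d (A c a).
Proof.
move=> AB; rewrite /dlog (invGLE AB) /mxtrace.
by apply: eq_bigr => a _; rewrite mxE; apply: eq_bigr => c _; rewrite mxE.
Qed.

Lemma d_one : d 1 = 0.
Proof.
have := d_mul 1 1; rewrite mulr1 scale1r => /eqP.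
by rewrite -[X in X == _]addr0 (inj_eq (addrI _)) => /eqP.
Qed.

Lemma d_mx1 n (a b : 'I_n) : d ((1%:M : 'M[R]_n) a b) = 0.
Proof. by rewrite mxE; case: (a == b); rewrite ?raddf0 ?d_one. Qed.

Lemma d_mulmx n (A B : 'M[R]_n) a b :
  d ((A *m B) a b) = \sum_c (A a c *: d (B c b) + B c b *: d (A a c)).
Proof. by rewrite mxE raddf_sum; apply: eq_bigr => c _; apply: d_mul. Qed.

Lemma sum_mx1 n (v : 'I_n -> V) a :
  \sum_b (1%:M : 'M[R]_n) a b *: v b = v a.
Proof.
rewrite (bigD1 a) //= mxE eqxx scale1r big1 ?addr0 // => b ba.
by rewrite mxE eq_sym (negbTE ba) scale0r.
Qed.

(** With A A' and inverse B' B, the Leibniz rule splits the trace in two.  In the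
    part with A' differentiated, B A = 1 cancels in the middle of B' B A dA'.
    In the part with A differentiated, A' B' = 1 cancels after a cyclic
    permutation of B' B dA A'. *)
Lemma dlogM n (A B A' B' : 'M[R]_n) : A *m B = 1%:M -> A' *m B' = 1%:M ->
  dlog d (A *m A') = dlog d A + dlog d A'.
Proof.
move=> AB A'B'.
have BA := mulmx1C AB.
have inv : (A *m A') *m (B' *m B) = 1%:M.
  by rewrite mulmxA -(mulmxA A) A'B' mulmx1.
have -> : dlog d A = \sum_a \sum_c \sum_e
    (B' *m B) a c *: (A' e a *: d (A c e)).
  rewrite (dlogE AB) exchange_big /= [RHS]exchange_big /=.
  apply: eq_bigr => c _; rewrite [RHS]exchange_big /=; apply: eq_bigr => e _.
  rewrite -[B in LHS]mul1mx -A'B' -mulmxA mxE scaler_suml.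
  by apply: eq_bigr => a _; rewrite scalerA mulrC.
have -> : dlog d A' = \sum_a \sum_c \sum_e
    (B' *m B) a c *: (A c e *: d (A' e a)).
  rewrite (dlogE A'B'); apply: eq_bigr => a _.
  rewrite exchange_big /=; apply: eq_bigr => e _.
  rewrite -[B' in LHS]mulmx1 -BA mulmxA mxE scaler_suml.
  by apply: eq_bigr => c _; rewrite scalerA.
rewrite (dlogE inv) -big_split; apply: eq_bigr => a _ /=.
rewrite -big_split; apply: eq_bigr => c _ /=.
rewrite d_mulmx scaler_sumr -big_split; apply: eq_bigr => e _ /=.
by rewrite scalerDr addrC.
Qed.

Lemma dlog1 n : dlog d (1%:M : 'M[R]_n) = 0.
Proof.
rewrite (dlogE (mulmx1 _)) big1 // => a _; rewrite big1 // => c _.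
by rewrite d_mx1 scaler0.
Qed.

(** The rule d(A^-1) = - A^-1 dA A^-1: differentiate A A^-1 = 1 and multiply on
    the left by A^-1. *)
Lemma d_invmx n (A B : 'M[R]_n) a b : A *m B = 1%:M ->
  d (B a b) = - \sum_e \sum_f (B a e * B f b) *: d (A e f).
Proof.
move=> AB; have BA := mulmx1C AB.
(* The (e, b) entry of A dB = - dA B. *)
have eq0 e : \sum_f A e f *: d (B f b) = - \sum_f B f b *: d (A e f).
  apply/eqP; rewrite -subr_eq0 opprK -big_split -d_mulmx AB.
  by rewrite d_mx1.
rewrite -(sum_mx1 (fun f => d (B f b)) a) -BA.
under eq_bigr do rewrite mxE scaler_suml.
rewrite exchange_big -sumrN; apply: eq_bigr => e _ /=.
under eq_bigr do rewrite -scalerA.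
rewrite -scaler_sumr eq0 scalerN scaler_sumr; congr (- _).
by apply: eq_bigr => f _; rewrite scalerA.
Qed.

End LogarithmicDerivative.

(** Naturality of dlog, for use with the restriction maps of the sheaves. *)
Lemma dlog_map (R R' : comPzRingType) (V : lmodType R) (V' : lmodType R')
    (d : {additive R -> V}) (d' : {additive R' -> V'})
    (f : {rmorphism R -> R'}) (fV : {additive V -> V'})
    (fZ : forall a v, fV (a *: v) = f a *: fV v)
    (fd : forall a, d' (f a) = fV (d a)) n (A B : 'M[R]_n) :
  A *m B = 1%:M -> fV (dlog d A) = dlog d' (map_mx f A).
Proof.
move=> AB; have ABf : map_mx f A *m map_mx f B = 1%:M.
  by rewrite -map_mxM AB map_mx1.
rewrite (dlogE d AB) (dlogE d' ABf) raddf_sum; apply: eq_bigr => a _.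
by rewrite raddf_sum; apply: eq_bigr => c _; rewrite fZ !mxE fd.
Qed.

(** * Sums over a symmetric group and division by two *)

Lemma big_S2 (V : nmodType) (F : 'S_2 -> V) :
  \sum_(s : 'S_2) F s = F (1%g : 'S_2) + F (tperm ord0 ord_max).
Proof.
rewrite (bigD1 (1%g : 'S_2)) //= (bigD1 (tperm ord0 ord_max)) /=; last first.
  by apply/eqP => /permP /(_ ord0); rewrite tpermL perm1.
rewrite [X in _ + (_ + X)]big1 ?addr0 // => s /andP[s1 st]; exfalso.
have I2 (x : 'I_2) : x = ord0 \/ x = ord_max.
  by case: x => [[|[|//]] ?]; [left | right]; apply: val_inj.
case: (I2 (s ord0)) (I2 (s ord_max)) => s0 [] sm.
- by have := perm_inj (etrans s0 (esym sm)).
- case/eqP: s1; apply/permP => x; rewrite perm1.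
  by case: (I2 x) => ->.
- case/eqP: st; apply/permP => x.
  by case: (I2 x) => ->; rewrite ?tpermL ?tpermR.
- by have := perm_inj (etrans s0 (esym sm)).
Qed.

Section Halving.
Variables (K : fieldType) (X : schemeOver K).
Hypothesis char_neq2 : 2%N \notin [pchar K].

Lemma two_neq0 : (2%:R : K) != 0.
Proof. by move: char_neq2; rewrite inE /=. Qed.

Lemma sc_constD (U : opens X) (a b : K) :
  sc_const U (a + b) = sc_const U a + sc_const U b.
Proof. by rewrite /sc_const !rmorphD. Qed.

Lemma sc_const1 (U : opens X) : sc_const U 1 = 1.
Proof. by rewrite /sc_const !rmorph1. Qed.

Lemma sc_constN (U : opens X) (a : K) : sc_const U (- a) = - sc_const U a.
Proof. by rewrite /sc_const !rmorphN. Qed.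

(** Every module over the structure sheaf is a vector space over K through the
    structure morphism; this is where the characteristic enters. *)
Lemma scale_half (F : modSheaf \O_X) (U : opens X) (v : F U) :
  sc_const U (2%:R^-1) *: (v + v) = v.
Proof.
rewrite scalerDr -scalerDl -sc_constD.
have -> : (2%:R^-1 + 2%:R^-1 : K) = 1.
  by rewrite -[2%:R^-1]mul1r -mulrDl -mulr2n mulfV ?two_neq0.
by rewrite sc_const1 scale1r.
Qed.

Lemma eq_opp0 (F : modSheaf \O_X) (U : opens X) (v : F U) : v = - v -> v = 0.
Proof. by move=> e; rewrite -(scale_half v) {2}e subrr scaler0. Qed.

End Halving.

(** * Closedness *)

Section AltPairing.
Variables (X : topologicalType) (O : ringSheaf X) (F G : modSheaf O).
Variables (w : altPairing F G) (U : opens X).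
Implicit Types s t : F U.

Lemma apDl s s' t : w U (s + s') t = w U s t + w U s' t.
Proof. by have := ap_linl w 1 s s' t; rewrite !scale1r. Qed.

Lemma ap0l t : w U 0 t = 0.
Proof. by apply: (addrI (w U 0 t)); rewrite -apDl !addr0. Qed.

Lemma apZl a s t : w U (a *: s) t = a *: w U s t.
Proof. by rewrite -[a *: s]addr0 ap_linl ap0l addr0. Qed.

Lemma apNl s t : w U (- s) t = - w U s t.
Proof. by rewrite -scaleN1r apZl scaleN1r. Qed.

Lemma ap_suml (I : finType) (f : I -> F U) t :
  w U (\sum_i f i) t = \sum_i w U (f i) t.
Proof.
apply: (big_morph (fun s => w U s t) _ (ap0l t)) => s s'.
exact: apDl.
Qed.

Lemma apDr s t t' : w U s (t + t') = w U s t + w U s t'.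
Proof. by have := ap_linr w 1 s t t'; rewrite !scale1r. Qed.

Lemma ap_anti s t : w U s t = - w U t s.
Proof.
apply/eqP; rewrite -addr_eq0; apply/eqP.
by have := ap_alt w (s + t); rewrite apDl !apDr !ap_alt add0r addr0.
Qed.

End AltPairing.

(** The relabelling which exchanges the two factors of tr (theta /\ theta). *)
Lemma sum4_rev (I : finType) (V : nmodType) (H : I -> I -> I -> I -> V) :
  \sum_a \sum_c \sum_e \sum_f H f e c a =
  \sum_a \sum_c \sum_e \sum_f H a c e f.
Proof.
have H4 (H' : I -> I -> I -> I -> V) :
    \sum_a \sum_c \sum_e \sum_f H' a c e f =
    \sum_(p : I * I) \sum_(q : I * I) H' p.1 p.2 q.1 q.2.
  by rewrite pair_bigA; apply: eq_bigr => p _; rewrite pair_bigA.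
have sw (H' : I * I -> V) : \sum_p H' p = \sum_p H' (p.2, p.1).
  by apply: reindex_inj => -[? ?] [? ?] [-> ->].
rewrite (H4 (fun a c e f => H f e c a)) H4 exchange_big /= sw.
by apply: eq_bigr => p _; rewrite [LHS]sw.
Qed.

Section Closed.
Variables (K : fieldType) (X : schemeOver K) (D : deRham X).
Hypothesis char_neq2 : 2%N \notin [pchar K].

Lemma dlog_closed (U : opens X) n (A B : 'M[\O_X U]_n) : A *m B = 1%:M ->
  dR_d1 D U (dlog (dR_d0 D U) A) = 0.
Proof.
move=> AB; have dM := dv_mul (dR_d0 D) (U := U).
(* T is tr (theta /\ theta) for theta = B dA, before grouping the factors. *)
pose T := \sum_a \sum_c \sum_e \sum_f (B a e * B f c) *:
   dR_wedge D U (dR_d0 D U (A e f)) (dR_d0 D U (A c a)).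
have -> : dR_d1 D U (dlog (dR_d0 D U) A) = - T.
  rewrite (dlogE _ AB) raddf_sum -sumrN; apply: eq_bigr => a _.
  rewrite raddf_sum -sumrN; apply: eq_bigr => c _.
  rewrite dR_d1_leibniz dR_d1_d0 scaler0 addr0 (d_invmx dM _ _ AB) apNl.
  rewrite ap_suml; congr (- _); apply: eq_bigr => e _.
  by rewrite ap_suml; apply: eq_bigr => f _; rewrite apZl.
rewrite (eq_opp0 char_neq2 (v := T)) ?oppr0 //.
rewrite {1}/T -sum4_rev -sumrN; apply: eq_bigr => a _.
rewrite -sumrN; apply: eq_bigr => c _; rewrite -sumrN; apply: eq_bigr => e _.
rewrite -sumrN; apply: eq_bigr => f _.
by rewrite ap_anti scalerN mulrC.
Qed.
End Closed.

(** * Changes of trivialization *)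

Section ChangeOfTriv.
Variables (X : topologicalType) (O : ringSheaf X) (M : nat) (E : modSheaf O).
Implicit Types U V W : opens X.

(** The matrix of p o q^-1 on any open set W contained in both domains, not only
    on their intersection: cocycle identities and refinements compare such
    matrices on smaller open sets. *)
Definition triv_mx U V (p : localTriv M E U) (q : localTriv M E V) W
    (hU : W `<=` U) (hV : W `<=` V) : 'M[O W]_M :=
  \matrix_(a, b) lt_fun p hU (lt_inv q hV (delta_mx b 0)) a 0.

Lemma lt_fun_sum U (p : localTriv M E U) W (h : W `<=` U) (I : finType)
    (a : I -> O W) (s : I -> E W) :
  lt_fun p h (\sum_b a b *: s b) = \sum_b a b *: lt_fun p h (s b).
Proof.
apply: etrans (linear_sum (lt_fun p h) _ _ _) _.
by apply: eq_bigr => b _; apply: (linearZZ (lt_fun p h)).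
Qed.

Lemma triv_mxE U V (p : localTriv M E U) (q : localTriv M E V) W
    (hU : W `<=` U) (hV : W `<=` V) (v : 'cV[O W]_M) :
  lt_fun p hU (lt_inv q hV v) = triv_mx p q hU hV *m v.
Proof.
have -> : lt_inv q hV v = \sum_b v b 0 *: lt_inv q hV (delta_mx b 0).
  apply: (can_inj (lt_funK q hV)); rewrite lt_invK lt_fun_sum.
  rewrite [LHS]matrix_sum_delta; apply: eq_bigr => b _.
  by rewrite big_ord1 lt_invK.
rewrite lt_fun_sum; apply/matrixP => a z; rewrite ord1 summxE mxE.
by apply: eq_bigr => b _; rewrite !mxE mulrC.
Qed.

Lemma triv_mxM U V V' (p : localTriv M E U) (q : localTriv M E V)
    (r : localTriv M E V') W (hU : W `<=` U) (hV : W `<=` V) (hV' : W `<=` V') :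
  triv_mx p q hU hV *m triv_mx q r hV hV' = triv_mx p r hU hV'.
Proof.
apply/matrixP => a b.
rewrite [RHS]mxE -(lt_funK q hV (lt_inv r hV' _)) triv_mxE !mxE.
by apply: eq_bigr => c _; rewrite !mxE.
Qed.

Lemma triv_mx1 U (p : localTriv M E U) W (h h' : W `<=` U) :
  triv_mx p p h h' = 1%:M.
Proof.
by apply/matrixP => a b; rewrite (Prop_irrelevance h' h) !mxE lt_invK mxE andbT.
Qed.

Lemma triv_mxV U V (p : localTriv M E U) (q : localTriv M E V) W
    (hU : W `<=` U) (hV : W `<=` V) :
  triv_mx p q hU hV *m triv_mx q p hV hU = 1%:M.
Proof. by rewrite triv_mxM triv_mx1. Qed.

Lemma triv_mx_res U V (p : localTriv M E U) (q : localTriv M E V) W W'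
    (hU : W `<=` U) (hV : W `<=` V) (h : W' `<=` W)
    (hU' : W' `<=` U) (hV' : W' `<=` V) :
  map_mx (rg_res O h) (triv_mx p q hU hV) = triv_mx p q hU' hV'.
Proof.
apply/matrixP => a b; rewrite !mxE.
have -> : lt_inv q hV' (delta_mx b 0) = md_res E h (lt_inv q hV (delta_mx b 0)).
  apply: (can_inj (lt_funK q hV')).
  by rewrite lt_invK (lt_res q hV h hV') lt_invK map_delta_mx.
by rewrite (lt_res p hU h hU') mxE.
Qed.
End ChangeOfTriv.

(** * The form attached to two trivializations *)

Section TrivDlog.
Variables (K : fieldType) (X : schemeOver K) (D : deRham X).
Hypothesis char_neq2 : 2%N \notin [pchar K].
Variables (M : nat) (E : modSheaf \O_X).
Implicit Types U V W : opens X.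

Definition triv_dlog U V (p : localTriv M E U) (q : localTriv M E V) W
    (hU : W `<=` U) (hV : W `<=` V) : dR_Om1 D W :=
  dlog (dR_d0 D W) (triv_mx p q hU hV).

Lemma triv_dlog_closed U V (p : localTriv M E U) (q : localTriv M E V) W
    (hU : W `<=` U) (hV : W `<=` V) : dR_d1 D W (triv_dlog p q hU hV) = 0.
Proof. exact: dlog_closed char_neq2 _ _ _ _ (triv_mxV p q hU hV). Qed.

Lemma triv_dlogD U V V' (p : localTriv M E U) (q : localTriv M E V)
    (r : localTriv M E V') W (hU : W `<=` U) (hV : W `<=` V) (hV' : W `<=` V') :
  triv_dlog p q hU hV + triv_dlog q r hV hV' = triv_dlog p r hU hV'.
Proof.
rewrite /triv_dlog -(triv_mxM p q r hU hV hV').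
rewrite (dlogM _ (triv_mxV p q hU hV) (triv_mxV q r hV hV')) //.
exact: dv_mul.
Qed.

Lemma triv_dlog_id U (p : localTriv M E U) W (h h' : W `<=` U) :
  triv_dlog p p h h' = 0.
Proof. by rewrite /triv_dlog triv_mx1 dlog1 //; apply: dv_mul. Qed.

Lemma triv_dlogN U V (p : localTriv M E U) (q : localTriv M E V) W
    (hU : W `<=` U) (hV : W `<=` V) :
  triv_dlog q p hV hU = - triv_dlog p q hU hV.
Proof. by apply/eqP; rewrite -addr_eq0 triv_dlogD triv_dlog_id. Qed.

Lemma triv_dlog_res U V (p : localTriv M E U) (q : localTriv M E V) W W'
    (hU : W `<=` U) (hV : W `<=` V) (h : W' `<=` W)
    (hU' : W' `<=` U) (hV' : W' `<=` V) :
  md_res (dR_Om1 D) h (triv_dlog p q hU hV) = triv_dlog p q hU' hV'.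
Proof.
rewrite /triv_dlog -(triv_mx_res p q hU hV h).
apply: dlog_map (triv_mxV p q hU hV) => *.
  by rewrite md_resZ.
exact: dv_res.
Qed.

Definition triv_form U V (p : localTriv M E U) (q : localTriv M E V) W
    (hU : W `<=` U) (hV : W `<=` V) : closedForms D W :=
  closed_form_of (triv_dlog_closed p q hU hV).

Section Cover.
Variables (C : openCover X) (g : transition_family \O_X M C).
Variable phi : trivialization M E C.
Hypothesis g_phi : forall i j, g i j = transition phi i j.

Lemma tr_dlogE (i j : cv_idx C) :
  tr_dlog D g i j = triv_dlog (phi i) (phi j) (@U1_l _ C i j) (@U1_r _ C i j).
Proof. by rewrite /tr_dlog g_phi. Qed.

(** The two permutations contribute (1/2) L(p_i, p_j) and - (1/2) L(p_j, p_i),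
    which are equal by antisymmetry. *)
Lemma T1_formE (i j : cv_idx C) :
  T1_form D g i j = triv_dlog (phi i) (phi j) (@U1_l _ C i j) (@U1_r _ C i j).
Proof.
have res a b a' b' (h : U1 a' b' `<=` U1 a b) (hl : U1 a' b' `<=` C a)
    (hr : U1 a' b' `<=` C b) :
  md_res (dR_Om1 D) h (tr_dlog D g a b) = triv_dlog (phi a) (phi b) hl hr.
  by rewrite tr_dlogE (triv_dlog_res _ _ _ _ _ hl hr).
(* The indices of a term are only propositionally equal to i and j, and occur in
   the type of the form; they are replaced while they are variables. *)
have resE a b i0 j0 (h : U1 i j `<=` U1 a b) (ea : a = i0) (eb : b = j0)
    (hl : U1 i j `<=` C i0) (hr : U1 i j `<=` C j0) :
  md_res (dR_Om1 D) h (tr_dlog D g a b) = triv_dlog (phi i0) (phi j0) hl hr.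
  by subst i0 j0; apply: res.
rewrite /T1_form big_S2 (resE _ _ i j _ _ _ (@U1_l _ C i j) (@U1_r _ C i j)).
- rewrite (resE _ _ j i _ _ _ (@U1_r _ C i j) (@U1_l _ C i j)).
  + rewrite odd_perm1 odd_tperm /= expr0 expr1 mulN1r mul1r sc_constN.
    rewrite (triv_dlogN (phi i) (phi j)) scalerN scaleNr opprK -scalerDr.
    exact: scale_half.
  + by rewrite tpermL.
  + by rewrite tpermR.
- by rewrite perm1.
- by rewrite perm1.
Qed.

End Cover.
End TrivDlog.

(** * The Cech class *)

Section Cochain.
Variables (K : fieldType) (X : schemeOver K) (D : deRham X).
Hypothesis char_neq2 : 2%N \notin [pchar K].
Variables (M : nat) (E : modSheaf \O_X).
Let F := closedForms D.

(** Allowing each trivialization to live on an open set larger than the member of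
    the cover makes a system over C into a system over any refinement of C,
    without restricting the trivializations. *)
Record trivOver (C : openCover X) := TrivOver {
  to_open : cv_idx C -> opens X;
  to_sub : forall k, C k `<=` to_open k;
  to_triv : forall k, localTriv M E (to_open k) }.

Lemma to_subl (C : openCover X) (p : trivOver C) (i j : cv_idx C) :
  U1 i j `<=` to_open p i.
Proof. by move=> x /U1_l /to_sub. Qed.

Lemma to_subr (C : openCover X) (p : trivOver C) (i j : cv_idx C) :
  U1 i j `<=` to_open p j.
Proof. by move=> x /U1_r /to_sub. Qed.

Definition triv_cochain (C : openCover X) (p : trivOver C) : cochain1 F C :=
  fun s => triv_form D char_neq2 (to_triv p (s1_0 s)) (to_triv p (s1_1 s))
    (@to_subl C p _ _) (@to_subr C p _ _).

Lemma triv_cochain_cocycle (C : openCover X) (p : trivOver C) :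
  cech_d1 (triv_cochain p) = 0.
Proof.
apply: functional_extensionality_dep => s; apply: val_inj => /=.
have h0 : U2 (s2_0 s) (s2_1 s) (s2_2 s) `<=` to_open p (s2_0 s).
  by move=> x /U2_01 /U1_l /to_sub.
have h1 : U2 (s2_0 s) (s2_1 s) (s2_2 s) `<=` to_open p (s2_1 s).
  by move=> x /U2_01 /U1_r /to_sub.
have h2 : U2 (s2_0 s) (s2_1 s) (s2_2 s) `<=` to_open p (s2_2 s).
  by move=> x /U2_12 /U1_r /to_sub.
rewrite (triv_dlog_res D _ _ _ _ _ h1 h2) (triv_dlog_res D _ _ _ _ _ h0 h2).
rewrite (triv_dlog_res D _ _ _ _ _ h0 h1).
rewrite -(triv_dlogD D _ (to_triv p (s2_1 s)) _ h0 h1 h2).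
by rewrite addrAC [X in X - _]addrC subrr.
Qed.

(** The two cochains are cohomologous through the forms L(q_k, p_k), which
    compare the two trivializations on each member of the cover. *)
Lemma triv_cochainB (C : openCover X) (p q : trivOver C) :
  exists c : cochain0 F C, triv_cochain p - triv_cochain q = cech_d0 c.
Proof.
exists (fun k => triv_form D char_neq2 (to_triv q k) (to_triv p k)
  (@to_sub C q k) (@to_sub C p k)).
apply: functional_extensionality_dep => s; apply: val_inj => /=.
rewrite !(triv_dlog_res D _ _ _ _ _ (@to_subr C q _ _) (@to_subr C p _ _)).
rewrite !(triv_dlog_res D _ _ _ _ _ (@to_subl C q _ _) (@to_subl C p _ _)).
apply/eqP; rewrite subr_eq addrAC eq_sym subr_eq; apply/eqP.
rewrite addrC (triv_dlogD D _ (to_triv q (s1_1 s))).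
by rewrite addrC (triv_dlogD D _ (to_triv p (s1_0 s))).
Qed.

Definition triv_cocycle (C : openCover X) (p : trivOver C) : cocycle1 F C :=
  cocycle_of (triv_cochain_cocycle p).

Lemma triv_class_indep (C : openCover X) (p q : trivOver C) :
  cech_class (triv_cocycle p) = cech_class (triv_cocycle q).
Proof.
apply/cech_class_eq/is_coboundaryP; have [c pq] := triv_cochainB p q.
by exists c; rewrite -pq.
Qed.

Definition trivOver_self (C : openCover X) (phi : trivialization M E C) :
  trivOver C := TrivOver (fun k => @subset_refl _ (C k)) phi.

Definition trivOver_refine (C C' : openCover X) (r : cv_idx C' -> cv_idx C)
    (hr : is_refinement r) (phi : trivialization M E C) : trivOver C' :=
  TrivOver hr (fun k => phi (r k)).

(** The alternating extension, which pullbacks along refinements use, is given by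
    the same formula for indices in any order, because L is antisymmetric. *)
Lemma triv_cochain_alt (C : openCover X) (p : trivOver C) (i j : cv_idx C) :
  cochain1_alt (triv_cochain p) i j =
  triv_form D char_neq2 (to_triv p i) (to_triv p j)
    (@to_subl C p i j) (@to_subr C p i j).
Proof.
apply: val_inj; case: (ltgtP i j) => [ij|ji|->].
- by rewrite (cochain1_alt_lt _ ij).
- rewrite (cochain1_alt_gt _ ji) /=.
  rewrite (triv_dlog_res D _ _ _ _ _ (@to_subr C p i j) (@to_subl C p i j)).
  by rewrite triv_dlogN opprK.
- by rewrite cochain1_alt_eq /= triv_dlog_id.
Qed.

Lemma triv_class_pull (C C' : openCover X) (r : cv_idx C' -> cv_idx C)
    (hr : is_refinement r) (phi : trivialization M E C) :
  cechH1_pull hr (cech_class (triv_cocycle (trivOver_self phi))) =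
  cech_class (triv_cocycle (trivOver_refine hr phi)).
Proof.
rewrite cechH1_pullE; congr cech_class; apply: val_inj.
apply: functional_extensionality_dep => s; apply: val_inj.
rewrite /= /cochain1_pull triv_cochain_alt /=.
exact: triv_dlog_res.
Qed.

Definition meet_cover (C C' : openCover X) : openCover X.
Proof.
apply: (@OpenCover X _ (cv_idx C *l cv_idx C')%type
  (fun k => oI (C k.1) (C' k.2))) => x.
have [i xi] := cv_cover C x; have [j xj] := cv_cover C' x.
by exists (i, j).
Defined.

(** On the common refinement both classes come from systems of trivializations
    over one cover, where [triv_class_indep] applies. *)
Lemma triv_can_indep (C C' : openCover X) (phi : trivialization M E C)
    (psi : trivialization M E C') :
  cech_can (cech_class (triv_cocycle (trivOver_self phi))) =
  cech_can (cech_class (triv_cocycle (trivOver_self psi))).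
Proof.
pose r (k : cv_idx (meet_cover C C')) : cv_idx C := k.1.
pose r' (k : cv_idx (meet_cover C C')) : cv_idx C' := k.2.
have hr : is_refinement r by move=> k x [].
have hr' : is_refinement r' by move=> k x [].
have can_pull C1 C2 (s : cv_idx C2 -> cv_idx C1) (hs : is_refinement s)
    (a : cechH1 F C1) : cech_can a = cech_can (cechH1_pull hs a).
  by apply/cech_can_eq/rst_step; exists s, hs.
rewrite (can_pull _ _ _ hr) (can_pull _ _ _ hr').
by rewrite !triv_class_pull (triv_class_indep _ (trivOver_refine hr' psi)).
Qed.

Lemma T1_cochainE (C : openCover X) (g : transition_family \O_X M C)
    (phi : trivialization M E C) (g_phi : forall i j, g i j = transition phi i j)
    (cl : forall i j, dR_d1 D _ (T1_form D g i j) = 0) :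
  T1_cochain cl = triv_cochain (trivOver_self phi).
Proof.
apply: functional_extensionality_dep => s; apply: val_inj => /=.
rewrite (T1_formE D char_neq2 g_phi) /=.
by congr triv_dlog; apply: Prop_irrelevance.
Qed.

End Cochain.

Theorem mainTheorem12 (K : fieldType)
    (char_neq2 : 2%N \notin [pchar K]) (char_neq3 : 3%N \notin [pchar K])
    (X : schemeOver K) (D : deRham X)
    (M : nat) (E : modSheaf (sc_O X)) (E_free : locally_free M E) :
  (* the two expressions of t agree *)
  (forall (C : openCover X) (g : transition_family (sc_O X) M C),
     is_transition_system E g ->
     forall i j : cv_idx C, T1_form D g i j = tr_dlog D g i j) /\
  (* t is a closed form *)
  exists t_closed : forall (C : openCover X) (g : transition_family (sc_O X) M C),
    is_transition_system E g ->
    forall i j : cv_idx C, dR_d1 D (U1 i j) (T1_form D g i j) = 0,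
  (* the cochain is a cocycle *)
  exists t_cocycle : forall (C : openCover X) (g : transition_family (sc_O X) M C)
      (gE : is_transition_system E g),
    cech_d1 (T1_cochain (t_closed C g gE)) = 0,
  (* its class does not depend on the transition functions *)
  (forall (C : openCover X) (g h : transition_family (sc_O X) M C)
      (gE : is_transition_system E g) (hE : is_transition_system E h),
     T1_class (t_cocycle C g gE) = T1_class (t_cocycle C h hE)) /\
  (* the image of the class in the limit does not depend on the cover *)
  (forall (C C' : openCover X) (g : transition_family (sc_O X) M C)
      (h : transition_family (sc_O X) M C')
      (gE : is_transition_system E g) (hE : is_transition_system E h),
     cech_can (T1_class (t_cocycle C g gE)) =
     cech_can (T1_class (t_cocycle C' h hE))).
Proof.
split=> [C g [phi g_phi] i j|].
  by rewrite (T1_formE D char_neq2 g_phi) (tr_dlogE _ g_phi).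
have cl (C : openCover X) (g : transition_family \O_X M C) :
    is_transition_system E g ->
    forall i j, dR_d1 D (U1 i j) (T1_form D g i j) = 0.
  move=> [phi g_phi] i j; rewrite (T1_formE D char_neq2 g_phi).
  exact: triv_dlog_closed.
exists cl.
have cc (C : openCover X) (g : transition_family \O_X M C)
    (gE : is_transition_system E g) : cech_d1 (T1_cochain (cl C g gE)) = 0.
  have [phi g_phi] := gE; rewrite (T1_cochainE char_neq2 g_phi).
  exact: triv_cochain_cocycle.
exists cc.
have classE (C : openCover X) (g : transition_family \O_X M C)
    (gE : is_transition_system E g) : exists phi : trivialization M E C,
    T1_class (cc C g gE) =
    cech_class (triv_cocycle D char_neq2 (trivOver_self phi)).
  have [phi g_phi] := gE; exists phi; congr cech_class; apply: val_inj.
  exact: T1_cochainE.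
split=> [C g h gE hE|C C' g h gE hE].
- have [phi ->] := classE C g gE; have [psi ->] := classE C h hE.
  exact: triv_class_indep.
- have [phi ->] := classE C g gE; have [psi ->] := classE C' h hE.
  exact: triv_can_indep.
Qed.
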